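(* There are homotopy equivalences $\mathrm{VR}(T_{5,5};3)\simeq \bigvee_9 S^4$ and $\mathrm{VR}(T_{7,7};4)\simeq S^3$.
   Context: For a metric space $X$ and $r\ge 0$, $\mathrm{VR}(X;r)$ is the simplicial complex on vertex set $X$ whose simplices are the finite nonempty subsets of diameter at most $r$. $T_{n,n}$ is the set $\{0,\dots,n-1\}^2$ with metric $d((i,j),(i',j'))=\min\{|i-i'|,n-|i-i'|\}+\min\{|j-j'|,n-|j-j'|\}$, i.e. the vertex set of the $n\times n$ torus grid graph with its shortest-path metric. *)

(* Defs.v *)
From HB Require Import structures.
From mathcomp Require Import all_boot all_order all_algebra.
From mathcomp Require Import all_classical all_reals all_analysis.
Set Implicit Arguments. Unset Strict Implicit. Unset Printing Implicit Defensive.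
Import Order.TTheory GRing.Theory Num.Theory.
Import numFieldNormedType.Exports.
Local Open Scope classical_set_scope.
Local Open Scope ring_scope.

(** * The torus grid T_{n,n} with its shortest-path metric *)

Definition cycdist (n a b : nat) : nat :=
  let d := (if (a <= b)%N then b - a else a - b)%N in minn d (n - d).

Definition torus_dist (n : nat) (p q : 'I_n * 'I_n) : nat :=
  (cycdist n p.1 q.1 + cycdist n p.2 q.2)%N.

Definition VR_simplex (V : finType) (d : V -> V -> nat) (r : nat)
  (s : {set V}) : bool :=
  (s != finset.set0) && [forall x in s, forall y in s, (d x y <= r)%N].

(** * Geometric realization of a finite abstract simplicial complex on the
      vertex set V (given by its predicate of simplices), as the subspace of
      the product space V -> R of barycentric-coordinate functions whose
      support is a simplex. *)
Definition realization (R : realType) (V : finType) (simp : {set V} -> bool)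
  : set {ptws V -> R} :=
  [set f : {ptws V -> R} | (forall v, 0 <= f v) /\ \sum_(v : V) f v = 1 /\
           simp (finset (fun v => f v != 0))].
Arguments realization R [V] simp.

(* Euclidean spaces R^V are modelled as {ptws V -> R}: functions V -> R with
   the product topology (= the Euclidean topology, V being finite). *)

Definition sphere (R : realType) (k : nat) : set {ptws 'I_k.+1 -> R} :=
  [set x : {ptws 'I_k.+1 -> R} | \sum_(i < k.+1) x i ^+ 2 = 1].
Arguments sphere : clear implicits.

Definition sphere_pt (R : realType) (k : nat) : {ptws 'I_k.+1 -> R} :=
  fun i => if val i == 0%N then 1 else 0.
Arguments sphere_pt : clear implicits.

(* the wedge of m copies of S^k, realized inside (R^(k+1))^m as the union of
   the m coordinate spheres { x | x i \in S^k, x j = pt for j <> i },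
   which pairwise meet exactly at the point (pt,...,pt). *)
Definition wedge_spheres (R : realType) (m k : nat)
  : set {ptws 'I_m -> {ptws 'I_k.+1 -> R}} :=
  [set x : {ptws 'I_m -> {ptws 'I_k.+1 -> R}} | exists i : 'I_m, sphere R k (x i) /\
                            forall j, j != i -> x j = sphere_pt R k].
Arguments wedge_spheres : clear implicits.

Definition homotopic_to_id (R : realType) (X : topologicalType)
  (A : set X) (h : X -> X) : Prop :=
  exists H : R * X -> X,
    {within [set p : R * X | 0 <= p.1 <= 1 /\ A p.2], continuous H} /\
    (forall t a, 0 <= t <= 1 -> A a -> A (H (t, a))) /\
    (forall a, A a -> H (0, a) = h a) /\
    (forall a, A a -> H (1, a) = a).

Definition homotopy_equivalent (R : realType) (X Y : topologicalType)
  (A : set X) (B : set Y) : Prop :=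
  exists (f : X -> Y) (g : Y -> X),
    {within A, continuous f} /\ (f @` A `<=` B) /\
    {within B, continuous g} /\ (g @` B `<=` A) /\
    homotopic_to_id R A (g \o f) /\ homotopic_to_id R B (f \o g).

(* Main.v *)
(** Both complexes are clique complexes.  If the link of a vertex or an edge of a
    clique complex is a cone, then removing (or adding back) that vertex or edge
    is a deformation retraction, given by an explicit formula in barycentric
    coordinates.  A finite list of such moves, checked by computation, turns
    VR(T_{5,5}; 3) into the join of 10 points with the boundary of the
    4-dimensional cross-polytope, and VR(T_{7,7}; 4) into the join of 2 points
    with the boundary of the octahedron.  The join of m + 1 points with the
    l1-sphere S^(k-1) is a union of m + 1 cones; collapsing one of them leaves
    a wedge of m copies of S^k. *)

Require Import Defs.
From HB Require Import structures.
From mathcomp Require Import all_boot all_order all_algebra.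
From mathcomp Require Import all_classical all_reals all_analysis.
From mathcomp Require Import ring lra zify.
Import Order.TTheory GRing.Theory Num.Theory.
Import numFieldNormedType.Exports.

Set Implicit Arguments.
Unset Strict Implicit.
Unset Printing Implicit Defensive.
Local Open Scope classical_set_scope.
Local Open Scope ring_scope.

(** Two encodings let a single lemma carry the whole combinatorial reduction. A vertex is treated as
    the degenerate pair {u, u}, and an absent vertex is one that is not related to itself. Hence all
    intermediate complexes lie in the same ambient space and are described by Boolean matrices of
    the same size. The moves go both ways: for the 5-torus, vertex 0 alone is toggled five times. On
    the topological side, the cones that make up the join overlap, and maps defined cone by cone
    would have to be glued. Instead, each map or homotopy between the join and the wedge is one
    formula in ambient coordinates, built from sums, products, positive parts and division by a
    nonzero norm, so continuity is checked coordinatewise. The branches enter only when the formula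
    is evaluated. *)

(** * Coordinatewise limits and limits of real-valued functions *)

Lemma cvg_ptws (T : Type) (F : set_system T) {FF : Filter F} (I : eqType)
    (Y : topologicalType) (f : T -> {ptws I -> Y}) (l : {ptws I -> Y}) :
  (forall i, f t i @[t --> F] --> l i) -> f @ F --> l.
Proof.
move=> fl; apply/cvg_sup => i A.
case=> B [[C oC <-] /= Cl] BA.
have nC : nbhs (l i) C by exact: open_nbhs_nbhs.
have FC : F (fun t => C (f t i)) := fl i C nC.
suff : F (f @^-1` A) by [].
by apply: filterS FC => t Ct; exact: BA.
Qed.

Lemma cvg_proj (T : Type) (F : set_system T) {FF : Filter F} (I : eqType)
    (Y : topologicalType) (f : T -> {ptws I -> Y}) (l : {ptws I -> Y}) i :
  f @ F --> l -> f t i @[t --> F] --> l i.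
Proof. by move=> fl; apply: cvg_comp fl (@proj_continuous I (fun=> Y) i l). Qed.

Section RealLimits.
Context (R : realType) (T : Type) (F : set_system T) {FF : Filter F}.
Implicit Types f g : T -> R.

Lemma cvg_max f g (a b : R) :
  f @ F --> a -> g @ F --> b -> Num.max (f t) (g t) @[t --> F] --> Num.max a b.
Proof.
move=> fa gb; rewrite maxr_absE; under eq_fun do rewrite maxr_absE.
apply: cvgM; last exact: cvg_cst.
by apply: cvgD; [exact: cvgD|apply: cvg_norm; exact: cvgB].
Qed.

Lemma cvg_min f g (a b : R) :
  f @ F --> a -> g @ F --> b -> Num.min (f t) (g t) @[t --> F] --> Num.min a b.
Proof.
move=> fa gb; rewrite minr_absE; under eq_fun do rewrite minr_absE.
apply: cvgM; last exact: cvg_cst.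
by apply: cvgB; [exact: cvgD|apply: cvg_norm; exact: cvgB].
Qed.

Lemma cvg_sumr (I : Type) (r : seq I) (P : pred I) (f : I -> T -> R) (l : I -> R) :
  (forall i, P i -> f i @ F --> l i) ->
  (\sum_(i <- r | P i) f i t) @[t --> F] --> \sum_(i <- r | P i) l i.
Proof.
move=> fl; elim: r => [|i r IH].
  by rewrite big_nil; under eq_fun do rewrite big_nil; exact: cvg_cst.
rewrite big_cons; under eq_fun do rewrite big_cons.
by case: ifPn => Pi //; apply: cvgD => //; exact: fl.
Qed.

Lemma cvg_divr f g (a b : R) : b != 0 ->
  f @ F --> a -> g @ F --> b -> f t / g t @[t --> F] --> a / b.
Proof. by move=> b0 fa gb; apply: cvgM => //; exact: cvgV. Qed.

Lemma cvg_sqrt f (a : R) : f @ F --> a -> Num.sqrt (f t) @[t --> F] --> Num.sqrt a.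
Proof. by move=> fa; apply: cvg_comp fa (@sqrt_continuous R a). Qed.

End RealLimits.

(** * Homotopy equivalences of subsets *)

Section Homotopy.
Variable R : realType.

Lemma within_continuous_pair (X Y Z W : topologicalType) (A : set X) (B : set (Y * Z))
  (f : X -> Y) (g : X -> Z) (h : Y * Z -> W) :
  {within A, continuous f} -> {within A, continuous g} ->
  {within B, continuous h} -> (forall x, A x -> B (f x, g x)) ->
  {within A, continuous (fun x => h (f x, g x))}.
Proof.
move=> /subspace_continuousP cf /subspace_continuousP cg /subspace_continuousP ch AB.
apply/subspace_continuousP => x Ax.
apply: cvg_comp (ch _ (AB _ Ax)).
have fg : (f y, g y) @[y --> within A (nbhs x)] --> (f x, g x).
  exact: (cvg_pair (cf _ Ax) (cg _ Ax)).
move=> P BP.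
have fgP : \forall y \near x, A y -> B (f y, g y) -> P (f y, g y) := fg _ BP.
suff : \forall y \near x, A y -> P (f y, g y) by [].
by apply: filterS fgP => y BPy Ay; apply: (BPy Ay); exact: AB.
Qed.

Lemma within_continuousC (X Y Z : topologicalType) (A : set X) (B : set Y)
    (f : X -> Y) (g : Y -> Z) :
  {within A, continuous f} -> {within B, continuous g} ->
  (forall x, A x -> B (f x)) -> {within A, continuous (g \o f)}.
Proof.
move=> /subspace_continuousP cf /subspace_continuousP cg AB.
apply/subspace_continuousP => x Ax.
apply: cvg_comp (cg _ (AB _ Ax)) => P BP.
have fP : \forall y \near x, A y -> B (f y) -> P (f y) := cf _ Ax _ BP.
suff : \forall y \near x, A y -> P (f y) by [].
by apply: filterS fP => y BPy Ay; apply: (BPy Ay); exact: AB.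
Qed.

(** Pasting on two closed pieces: a point outside one piece has a neighbourhood that misses it, so
    that piece imposes no condition there. *)
Lemma within_continuous_cover (X Y : topologicalType) (A C D : set X) (f : X -> Y) :
  closed C -> closed D -> A `<=` C `|` D ->
  {within A `&` C, continuous f} -> {within A `&` D, continuous f} ->
  {within A, continuous f}.
Proof.
move=> cC cD ACD /subspace_continuousP fC /subspace_continuousP fD.
apply/subspace_continuousP => x Ax U Ufx.
suff : \forall y \near x, A y -> U (f y) by [].
have near_part (E : set X) : closed E ->
    (forall x, (A `&` E) x -> f @ within (A `&` E) (nbhs x) --> f x) ->
    \forall y \near x, A y -> E y -> U (f y).
  move=> cE fE; have [Ex|nEx] := pselect (E x).
    have fU : \forall y \near x, (A `&` E) y -> U (f y) := fE _ (conj Ax Ex) _ Ufx.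
    by apply: filterS fU => y Uy Ay Ey; exact: Uy.
  have nE : \forall y \near x, ~ E y.
    by apply: open_nbhs_nbhs; split => //; exact: closed_openC.
  by apply: filterS nE => y nEy Ay Ey.
apply: filterS2 (near_part _ cC fC) (near_part _ cD fD) => y UC UD Ay.
by case: (ACD _ Ay) => [Cy|Dy]; [exact: UC|exact: UD].
Qed.

Lemma within_continuous_eq (X Y : topologicalType) (A : set X) (f g : X -> Y) :
  (forall x, A x -> f x = g x) -> {within A, continuous f} -> {within A, continuous g}.
Proof.
move=> fg; apply: subspace_eq_continuous => x; rewrite inE.
exact: fg.
Qed.

Definition cylinder (X : Type) (A : set X) : set (R * X) :=
  [set p | 0 <= p.1 <= 1 /\ A p.2].

Lemma continuous_fst_within (X : topologicalType) (S : set (R * X)) :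
  {within S, continuous fst}.
Proof. by apply: continuous_subspaceT => -[t x]; exact: cvg_fst. Qed.

Lemma continuous_snd_within (X : topologicalType) (S : set (R * X)) :
  {within S, continuous snd}.
Proof. by apply: continuous_subspaceT => -[t x]; exact: cvg_snd. Qed.

Lemma homotopic_to_id_eq (X : topologicalType) (A : set X) (h : X -> X) :
  (forall a, A a -> h a = a) -> homotopic_to_id R A h.
Proof.
move=> ha; exists snd; split; first exact: continuous_snd_within.
by do ![split=> //] => a Aa; rewrite ha.
Qed.

(** Concatenation at double speed: [G] fills the first half of the time, the given homotopy from [k]
    to the identity the second, and both equal [k] at time 1/2. *)
Lemma homotopic_to_id_trans (X : topologicalType) (A : set X) (h k : X -> X)
    (G : R * X -> X) :
  {within cylinder A, continuous G} ->
  (forall t a, 0 <= t <= 1 -> A a -> A (G (t, a))) ->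
  (forall a, A a -> G (0, a) = h a) -> (forall a, A a -> G (1, a) = k a) ->
  homotopic_to_id R A k -> homotopic_to_id R A h.
Proof.
move=> cG AG G0 G1 [K [cK [AK [K0 K1]]]].
exists (fun p => if p.1 <= 2^-1 then G (2 * p.1, p.2) else K (2 * p.1 - 1, p.2)).
have c2 (S : set (R * X)) : {within S, continuous (fun p : R * X => 2 * p.1)}.
  apply/subspace_continuousP => p Sp; apply: cvgMl_tmp.
  by move/subspace_continuousP : (@continuous_fst_within X S); exact.
have c21 (S : set (R * X)) : {within S, continuous (fun p : R * X => 2 * p.1 - 1)}.
  apply/subspace_continuousP => p Sp; apply: cvgB; last exact: cvg_cst.
  by move/subspace_continuousP : (c2 S); exact.
have fst_cont : continuous (fst : R * X -> R) by move=> -[t x]; exact: cvg_fst.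
split; last first.
  split=> [t a t01 Aa|]; last split=> a Aa /=.
  - have /andP[t0 t1] := t01.
    case: ifPn => /= [tle|/negP tgt]; first by apply: AG => //; apply/andP; split; lra.
    by apply: AK => //; apply/andP; split; lra.
  - by rewrite invr_ge0 ler0n mulr0 G0.
  - rewrite ifF; last by apply/negP; lra.
    by have -> : 2 * 1 - 1 = 1 :> R; [lra|exact: K1].
apply: (@within_continuous_cover (R * X)%type X (cylinder A)
  [set p | p.1 <= 2^-1] [set p | 2^-1 <= p.1]).
- exact: (closed_comp (fun x _ => fst_cont x) (@closed_le _ 2^-1)).
- exact: (closed_comp (fun x _ => fst_cont x) (@closed_ge _ 2^-1)).
- by move=> p _ /=; case: (lerP p.1 2^-1) => [|/ltW]; [left|right].
- apply: (@within_continuous_eq (R * X)%type X _ (fun p => G (2 * p.1, p.2))).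
    by move=> p [_ /= ->].
  apply: within_continuous_pair (c2 _) (@continuous_snd_within _ _) cG _.
  by move=> p [[/= /andP[p0 p1] Ap] p2]; split=> //=; apply/andP; split; lra.
- apply: (@within_continuous_eq (R * X)%type X _ (fun p => K (2 * p.1 - 1, p.2))).
    move=> p [[/= _ Ap] ple]; case: ifPn => // pge.
    have -> : p.1 = 2^-1 by apply/eqP; rewrite eq_le pge.
    by rewrite divff ?subrr ?K0 ?G1.
  apply: within_continuous_pair (c21 _) (@continuous_snd_within _ _) cK _.
  by move=> p [[/= /andP[p0 p1] Ap] p2]; split=> //=; apply/andP; split; lra.
Qed.

Lemma homotopy_equivalent_sym (X Y : topologicalType) (A : set X) (B : set Y) :
  homotopy_equivalent R A B -> homotopy_equivalent R B A.
Proof.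
by move=> [f [g [cf [fAB [cg [gBA [gf fg]]]]]]]; exists g, f.
Qed.

(** The homotopy of [h] is run between [f] and [g], which leaves [g \o f]. Transitivity of homotopy
    equivalence uses this once for each composite. *)
Lemma homotopic_to_id_conj (X Y : topologicalType) (A : set X) (B : set Y)
    (f : X -> Y) (g : Y -> X) (h : Y -> Y) :
  {within A, continuous f} -> (forall x, A x -> B (f x)) ->
  {within B, continuous g} -> (forall y, B y -> A (g y)) ->
  homotopic_to_id R A (g \o f) -> homotopic_to_id R B h ->
  homotopic_to_id R A (g \o h \o f).
Proof.
move=> cf fAB cg gBA gf [H [cH [BH [H0 H1]]]].
apply: (@homotopic_to_id_trans _ _ _ (g \o f) (fun p => g (H (p.1, f p.2)))) => //.
- have cH' : {within cylinder A, continuous (fun p => H (p.1, f p.2))}.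
    apply: within_continuous_pair (@continuous_fst_within _ _) _ cH _.
      apply: (within_continuousC (@continuous_snd_within _ _) cf).
      by move=> p [].
    by move=> p [p01 /fAB].
  apply: (within_continuousC cH' cg) => p [p01 Ap]; apply: BH => //.
  exact: fAB.
- by move=> t a t01 Aa; apply/gBA/BH => //; exact: fAB.
- by move=> a Aa /=; rewrite H0 //; exact: fAB.
- by move=> a Aa /=; rewrite H1 //; exact: fAB.
Qed.

Lemma homotopy_equivalent_trans (X Y Z : topologicalType)
    (A : set X) (B : set Y) (C : set Z) :
  homotopy_equivalent R A B -> homotopy_equivalent R B C ->
  homotopy_equivalent R A C.
Proof.
move=> [f [g [cf [/image_subP fAB [cg [/image_subP gBA [gf fg]]]]]]].
move=> [f' [g' [cf' [/image_subP fBC [cg' [/image_subP gCB [gf' fg']]]]]]].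
exists (f' \o f), (g \o g'); split; first exact: within_continuousC cf cf' fAB.
split; first by apply/image_subP => x Ax; apply/fBC/fAB.
split; first exact: within_continuousC cg' cg gCB.
split; first by apply/image_subP => x Ax; apply/gBA/gCB.
split.
  exact: (homotopic_to_id_conj cf fAB cg gBA gf gf').
exact: (homotopic_to_id_conj cg' gCB cf' fBC fg' fg).
Qed.

Lemma homeomorphic_homotopy_equivalent (X Y : topologicalType) (A : set X) (B : set Y)
    (f : X -> Y) (g : Y -> X) :
  {within A, continuous f} -> (forall x, A x -> B (f x)) ->
  {within B, continuous g} -> (forall y, B y -> A (g y)) ->
  (forall x, A x -> g (f x) = x) -> (forall y, B y -> f (g y) = y) ->
  homotopy_equivalent R A B.
Proof.
move=> cf /image_subP fAB cg /image_subP gBA gf fg; exists f, g.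
by do 5!split=> //; exact: homotopic_to_id_eq.
Qed.

Lemma homotopy_equivalent_refl (X : topologicalType) (A : set X) :
  homotopy_equivalent R A A.
Proof.
have cid : {within A, continuous (@idfun X)} by apply: continuous_subspaceT => x; exact: cvg_id.
exact: (homeomorphic_homotopy_equivalent cid _ cid).
Qed.

(** One [H] serves both composites: since it preserves [B], its restriction to [B] is the second
    homotopy. *)
Lemma deformation_homotopy_equivalent (X : topologicalType) (A B : set X)
    (H : R * X -> X) :
  B `<=` A -> {within cylinder A, continuous H} ->
  (forall t a, 0 <= t <= 1 -> A a -> A (H (t, a))) ->
  (forall t b, 0 <= t <= 1 -> B b -> B (H (t, b))) ->
  (forall a, A a -> B (H (0, a))) -> (forall a, A a -> H (1, a) = a) ->
  homotopy_equivalent R A B.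
Proof.
move=> BA cH AH BH H0 H1.
have cc (S : set X) : {within S, continuous (fun=> 0 : R)}.
  by apply: continuous_subspaceT => x; exact: cvg_cst.
have ci (S : set X) : {within S, continuous (@idfun X)}.
  by apply: continuous_subspaceT => x; exact: cvg_id.
exists (fun a => H (0, a)), idfun; split.
  apply: (within_continuous_pair (cc _) (ci _) cH) => x Ax.
  by split=> //=; rewrite lexx ler01.
split; first exact/image_subP.
split; first exact: ci.
split; first by apply/image_subP => x /BA.
split; exists H; first by [].
split.
  by apply: continuous_subspaceW cH => -[t x] [/= t01 /BA].
by split=> //; split=> // a /BA; exact: H1.
Qed.

End Homotopy.

(** * Clique complexes *)

Definition clique_simplex (V : finType) (e : rel V) (s : {set V}) : bool :=
  (s != finset.set0) && [forall x in s, forall y in s, e x y].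

Section CliqueComplex.
Variable R : realType.

Definition clique_complex (V : finType) (e : rel V) : set {ptws V -> R} :=
  realization R (clique_simplex e).

(** Weights of sum 1 have nonempty support, so only the pairwise condition remains. Its case a = b
    says that a vertex unrelated to itself carries no weight. *)
Lemma clique_complexP (V : finType) (e : rel V) (x : {ptws V -> R}) :
  clique_complex e x <->
  [/\ forall v, 0 <= x v, \sum_v x v = 1 &
      forall a b, x a != 0 -> x b != 0 -> e a b].
Proof.
split=> [[x0 [x1 /andP[_ /forall_inP ex]]]|[x0 x1 ex]].
  split=> // a b xa xb; have := ex a; rewrite inE xa => /(_ isT)/forall_inP.
  by apply; rewrite inE.
split=> //; split=> //; apply/andP; split.
  apply/negP => /eqP/setP supp0; have /eqP := x1; rewrite big1 1?eq_sym ?oner_eq0 //.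
  by move=> v _; have := supp0 v; rewrite !inE => /negbFE/eqP.
by apply/forall_inP => a; rewrite inE => xa; apply/forall_inP => b; rewrite inE; exact: ex.
Qed.

(** Vertices outside the image of [h] are unrelated to themselves and carry no weight, so
    restriction along [h] loses nothing. *)
Lemma clique_complex_reindex (V W : finType) (h : W -> V) (e : rel V) (f : rel W) :
  injective h -> (forall a b, f a b = e (h a) (h b)) ->
  (forall v, e v v -> exists a, v = h a) ->
  homotopy_equivalent R (clique_complex e) (clique_complex f).
Proof.
move=> h_inj fe eh.
pose pull (x : {ptws V -> R}) : {ptws W -> R} := fun a => x (h a).
pose push (y : {ptws W -> R}) : {ptws V -> R} := fun v => \sum_(a | h a == v) y a.
have push_h y a : push y (h a) = y a.
  by rewrite /push (big_pred1 a) // => b; rewrite /= (inj_eq h_inj).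
have pushN y v : ~ (exists a, v = h a) -> push y v = 0.
  by move=> vN; rewrite /push big1 // => a /eqP hv; case: vN; exists a.
have push_neq0 y v : push y v != 0 -> exists2 a, v = h a & y a != 0.
  move=> yv; have [[a va]|vN] := pselect (exists a, v = h a).
    by exists a => //; rewrite -push_h -va.
  by rewrite pushN ?eqxx in yv.
have pullK x : clique_complex e x -> push (pull x) = x.
  move=> /clique_complexP[_ _ ex]; apply/funext => v.
  have [[a ->]|vN] := pselect (exists a, v = h a); first by rewrite push_h.
  rewrite pushN //; apply/esym/eqP/negP => /negP xv; apply: vN; apply: eh.
  exact: ex.
have sum_push y : \sum_v push y v = \sum_a y a.
  by rewrite [RHS](partition_big h predT).
apply: (@homeomorphic_homotopy_equivalent R _ _ _ _ pull push) => //.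
- apply/subspace_continuousP => x _; apply: cvg_ptws => a.
  by apply: (@cvg_proj _ _ _ _ _ id); apply: cvg_within.
- move=> x ex; have := ex => /clique_complexP[x0 x1 ee].
  apply/clique_complexP; split=> [a||a b xa xb]; first exact: x0.
  - by rewrite -sum_push pullK.
  - by rewrite fe; exact: ee.
- apply/subspace_continuousP => y _; apply: cvg_ptws => v.
  apply: cvg_sumr => a _.
  by apply: (@cvg_proj _ _ _ _ _ id); apply: cvg_within.
- move=> y /clique_complexP[y0 y1 ff]; apply/clique_complexP; split.
  + by move=> v; apply: sumr_ge0.
  + by rewrite sum_push.
  + by move=> _ _ /push_neq0[a -> ya] /push_neq0[b -> yb]; rewrite -fe; exact: ff.
- by move=> y _; apply/funext => a; rewrite /pull push_h.
Qed.

(** Equal amounts of mass slide from u and v to the apex w until the smaller of the two weights is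
    used up. The amount [m] is a minimum, hence continuous, and it vanishes on the smaller complex,
    which therefore stays fixed. The case u = v removes a vertex. *)
Lemma clique_complex_remove_pair (V : finType) (e e' : rel V) (u v w : V) :
  w != u -> w != v ->
  (forall a b, e' a b =
     e a b && ~~ ((a == u) && (b == v) || (a == v) && (b == u))) ->
  (e u u -> e v v -> e w w) ->
  (forall z, e u u -> e v v -> e z z -> e u z -> e v z -> e z w && e w z) ->
  homotopy_equivalent R (clique_complex e) (clique_complex e').
Proof.
move=> wu wv e'E eww cone.
pose ind a : R := ((a == u) || (a == v))%:R.
(* The mass freed per unit of [m]: 1 for a vertex (u = v), 2 for an edge. *)
pose c := \sum_a ind a.
have ind_ge0 a : 0 <= ind a by rewrite ler0n.
have c_ge0 : 0 <= c by apply: sumr_ge0.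
pose m (x : {ptws V -> R}) := Num.min (x u) (x v).
(* The cone apex w absorbs the mass pushed off u and v. *)
pose H (p : R * {ptws V -> R}) : {ptws V -> R} := fun a =>
  p.2 a + (1 - p.1) * m p.2 * ((a == w)%:R * c - ind a).
have m_ge0 x : (forall a, 0 <= x a) -> 0 <= m x by move=> x0; rewrite le_min !x0.
have ind_w : ind w = 0 by rewrite /ind (negPf wu) (negPf wv).
have Hm0 t x : m x = 0 -> H (t, x) = x.
  by move=> mx; apply/funext => a; rewrite /H /= mx mulr0 mul0r addr0.
have m_neq0 x : (forall a, 0 <= x a) -> m x != 0 -> x u != 0 /\ x v != 0.
  move=> x0 mx; have : 0 < m x by rewrite lt0r mx m_ge0.
  by rewrite lt_min => /andP[xu xv]; rewrite !gt_eqF.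
have H_ge0 t x a : 0 <= t <= 1 -> (forall a, 0 <= x a) -> 0 <= H (t, x) a.
  move=> /andP[t0 t1] x0; rewrite /H /=.
  have mx := m_ge0 _ x0.
  have [->|aw] /= := eqVneq a w.
    rewrite ind_w subr0 mul1r addr_ge0 // mulr_ge0 // mulr_ge0 //; lra.
  have -> : x a + (1 - t) * m x * (0 * c - ind a) = x a - (1 - t) * (m x * ind a) by ring.
  have indm : m x * ind a <= x a.
    rewrite /ind; have [->|au] /= := eqVneq a u; first by rewrite mulr1 ge_min lexx.
    have [->|av] := eqVneq a v; first by rewrite mulr1 ge_min lexx orbT.
    by rewrite mulr0.
  have : 0 <= m x * ind a by rewrite mulr_ge0.
  nra.
have H_sum t x : \sum_a H (t, x) a = \sum_a x a.
  rewrite big_split /= -mulr_sumr sumrB -mulr_suml.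
  rewrite -[X in (_ * (X * c - _))]/(\sum_a (a == w)%:R).
  have -> : \sum_a (a == w)%:R = 1 :> R.
    by rewrite (bigD1 w) //= eqxx big1 ?addr0 // => a /negPf ->.
  by rewrite mul1r subrr mulr0 addr0.
(* New weight can appear only at w, and only if u and v both carry weight; then the cone condition
   relates w to the whole support. *)
have H_supp t x a : 0 <= t <= 1 -> (forall a, 0 <= x a) -> H (t, x) a != 0 ->
    x a != 0 \/ (a = w /\ m x != 0).
  move=> t01 x0 Ha; have [mx|mx] := eqVneq (m x) 0; first by left; rewrite Hm0 in Ha.
  have [->|aw] := eqVneq a w; first by right.
  left; apply/negP => /eqP xa; move/negP : Ha; apply.
  rewrite eq_le H_ge0 // andbT /H /= xa (negPf aw) mul0r !add0r mulrN oppr_le0.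
  have mx0 := m_ge0 _ x0; case/andP: t01 => t0 t1.
  by rewrite mulr_ge0 // mulr_ge0 //; lra.
have H_clique t x : 0 <= t <= 1 -> clique_complex e x -> clique_complex e (H (t, x)).
  move=> t01 /clique_complexP[x0 x1 ex]; apply/clique_complexP; split=> [a||].
  - exact: H_ge0.
  - by rewrite H_sum.
  - have apex : m x != 0 -> forall z, x z != 0 -> e z w && e w z.
      by move=> /m_neq0 -/(_ x0)[xu xv] z xz; apply: cone; exact: ex.
    have apexw : m x != 0 -> e w w.
      by move=> /m_neq0 -/(_ x0)[xu xv]; apply: eww; exact: ex.
    move=> a b /H_supp-/(_ t01 x0) Ha /H_supp-/(_ t01 x0) Hb.
    case: Ha => [xa|[-> mx]]; case: Hb => [xb|[-> mx']].
    + exact: ex.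
    + by have /andP[] := apex mx' _ xa.
    + by have /andP[] := apex mx _ xb.
    + exact: apexw.
have subE : clique_complex e' `<=` clique_complex e.
  move=> x /clique_complexP[x0 x1 ex]; apply/clique_complexP; split=> // a b xa xb.
  by have := ex _ _ xa xb; rewrite e'E => /andP[].
have e'm0 x : clique_complex e' x -> m x = 0.
  move=> /clique_complexP[x0 _ ex]; apply/eqP/negP => /negP /m_neq0 -/(_ x0)[xu xv].
  by have := ex _ _ xu xv; rewrite e'E !eqxx andbF.
apply: (@deformation_homotopy_equivalent R _ _ _ H subE) => //.
- apply/subspace_continuousP => -[t x] _; apply: cvg_ptws => a.
  have cx b : p.2 b @[p --> within (cylinder (clique_complex e)) (nbhs (t, x))] --> x b.
    by apply: cvg_proj; apply: cvg_within_filter; exact: cvg_snd.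
  apply: cvgD; first exact: cx.
  apply: cvgMr_tmp; apply: cvgM; last exact: cvg_min.
  by apply: cvgB; [exact: cvg_cst|apply: cvg_within_filter; exact: cvg_fst].
- by move=> t x t01 ex; rewrite Hm0 //; exact: e'm0.
- move=> x ex; have t01 : (0 : R) <= (0 : R) <= (1 : R) by rewrite lexx ler01.
  have /clique_complexP[x0 x1 ee] := ex.
  have /clique_complexP[y0 y1 ey] := H_clique 0 x t01 ex.
  (* At time 0 both weights have dropped by their minimum. *)
  have Huv : (H (0, x) u == 0) || (H (0, x) v == 0).
    have [uw vw] : u == w = false /\ v == w = false.
      by rewrite ![_ == w]eq_sym (negPf wu) (negPf wv).
    rewrite /H /= /ind !eqxx orbT uw vw subr0 !mul1r !mul0r sub0r mulrN1 /m.
    by case: (leP (x u) (x v)) => _; rewrite subrr eqxx ?orbT.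
  apply/clique_complexP; split=> // a b Ha Hb; rewrite e'E ey //=.
  apply/negP => /orP[]/andP[/eqP ab /eqP ba]; subst a b; move: Huv;
    by rewrite (negPf Ha) (negPf Hb).
- by move=> x _; apply/funext => a; rewrite /H /= subrr !mul0r addr0.
Qed.

End CliqueComplex.
Arguments clique_complex R [V] e.

(** * Joins of points with cross-polytopes *)

Section Normalization.
Variables (R : realType) (n : nat).
Implicit Types v : 'I_n -> R.

Definition norm1 v : R := \sum_i `|v i|.
Definition norm2 v : R := Num.sqrt (\sum_i v i ^+ 2).
Definition normalize1 v : 'I_n -> R := fun i => v i / norm1 v.
Definition normalize2 v : 'I_n -> R := fun i => v i / norm2 v.

Lemma norm1_ge0 v : 0 <= norm1 v.
Proof. exact: sumr_ge0. Qed.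

Lemma norm1_eq0 v : norm1 v = 0 -> forall i, v i = 0.
Proof.
move=> v0 i; have := @psumr_eq0P _ _ predT (fun j => `|v j|) (fun _ _ => normr_ge0 _) v0 i isT.
by move=> /eqP; rewrite normr_eq0 => /eqP.
Qed.

Lemma norm2_neq0 v : norm1 v != 0 -> norm2 v != 0.
Proof.
apply: contra; rewrite sqrtr_eq0 => v0; apply/eqP; apply: big1 => i _.
have {}v0 : \sum_i v i ^+ 2 = 0.
  by apply/eqP; rewrite eq_le v0 sumr_ge0 // => j _; rewrite sqr_ge0.
have := @psumr_eq0P _ _ predT (fun j => v j ^+ 2) (fun _ _ => sqr_ge0 _) v0 i isT.
by move=> /eqP; rewrite sqrf_eq0 => /eqP ->; rewrite normr0.
Qed.

Lemma norm1_normalize1 v : norm1 v != 0 -> norm1 (normalize1 v) = 1.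
Proof.
move=> v0; rewrite /norm1 /normalize1.
under eq_bigr do rewrite normrM normfV (ger0_norm (norm1_ge0 v)).
by rewrite -mulr_suml divff.
Qed.

Lemma sum_sqr_normalize2 v : norm1 v != 0 -> \sum_i normalize2 v i ^+ 2 = 1.
Proof.
move=> /norm2_neq0 v0; rewrite /normalize2.
under eq_bigr do rewrite exprMn exprVn.
rewrite -mulr_suml sqr_sqrtr; last by apply: sumr_ge0 => i _; rewrite sqr_ge0.
rewrite divff //; apply: contra v0 => /eqP v0.
by rewrite /norm2 v0 sqrtr0.
Qed.

Lemma normalize1_id v : norm1 v = 1 -> normalize1 v = v.
Proof. by move=> v1; apply/funext => i; rewrite /normalize1 v1 divr1. Qed.

Lemma normalize2_id v : \sum_i v i ^+ 2 = 1 -> normalize2 v = v.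
Proof. by move=> v1; apply/funext => i; rewrite /normalize2 /norm2 v1 sqrtr1 divr1. Qed.

Lemma norm1_sphere_neq0 v : \sum_i v i ^+ 2 = 1 -> norm1 v != 0.
Proof.
move=> v1; apply/eqP => /norm1_eq0 v0; have /eqP := oner_neq0 R; apply.
by rewrite -v1 big1 // => i _; rewrite v0 expr0n.
Qed.

(** Used to read off nonvanishing from membership in the wedge, whose components are unit
    vectors. *)
Lemma norm1_normalize2_neq0 v : \sum_i normalize2 v i ^+ 2 = 1 -> norm1 v != 0.
Proof.
move=> /norm1_sphere_neq0; apply: contra => /eqP/norm1_eq0 v0.
by apply/eqP; apply: big1 => i _; rewrite /normalize2 v0 mul0r normr0.
Qed.

Lemma normalize1_normalize2 v : norm1 v != 0 -> normalize1 (normalize2 v) = normalize1 v.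
Proof.
move=> v0; have n2 := norm2_neq0 v0; apply/funext => i; rewrite /normalize1.
have -> : norm1 (normalize2 v) = norm1 v / norm2 v.
  rewrite /norm1 /normalize2 mulr_suml; apply: eq_bigr => j _.
  by rewrite normrM normfV (ger0_norm (sqrtr_ge0 _)).
by rewrite /normalize2; field; rewrite v0 n2.
Qed.

Section Limits.
Context (T : Type) (F : set_system T) {FF : Filter F}.
Variables (f : T -> 'I_n -> R) (l : 'I_n -> R).
Hypothesis fl : forall i, f t i @[t --> F] --> l i.
Hypothesis l0 : norm1 l != 0.

Lemma cvg_norm1 : norm1 (f t) @[t --> F] --> norm1 l.
Proof. by apply: cvg_sumr => i _; apply: cvg_norm; exact: fl. Qed.

Lemma cvg_normalize1 i : normalize1 (f t) i @[t --> F] --> normalize1 l i.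
Proof. by apply: cvg_divr; [exact: l0|exact: fl|exact: cvg_norm1]. Qed.

Lemma cvg_normalize2 i : normalize2 (f t) i @[t --> F] --> normalize2 l i.
Proof.
apply: cvg_divr; [exact: norm2_neq0|exact: fl|].
apply: cvg_sqrt; apply: cvg_sumr => j _.
rewrite expr2; under eq_fun do rewrite expr2.
by apply: cvgM; exact: fl.
Qed.

End Limits.
End Normalization.

(** * The join as a union of branches *)

Section Suspension.
Variables (R : realType) (m k : nat).

(** [inl] lists the discrete points of the join, [inr (j, b)] the two ends of the j-th axis of the
    cross-polytope. The shift to [m.+2] provides at least two points, hence at least one sphere. *)
Definition suspension_vertex : finType := ('I_m.+2 + 'I_k * bool)%type.

Definition suspension_rel : rel suspension_vertex := fun a b =>
  match a, b with
  | inl i, inl j => i == j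
  | inr p, inr q => (p.1 == q.1) ==> (p.2 == q.2)
  | _, _ => true
  end.

Definition pos (r : R) : R := Num.max r 0.

Lemma pos_ge0 r : 0 <= pos r. Proof. by rewrite le_max lexx orbT. Qed.
Lemma pos_id r : 0 <= r -> pos r = r. Proof. by move=> r0; apply/max_idPl. Qed.
Lemma pos_eq0 r : r <= 0 -> pos r = 0. Proof. by move=> r0; apply/max_idPr. Qed.
Lemma pos0 : pos 0 = 0. Proof. exact: pos_id. Qed.
Lemma posDN r : pos r + pos (- r) = `|r|.
Proof.
case: (lerP 0 r) => r0; first by rewrite pos_id // pos_eq0 ?oppr_le0 // addr0 ger0_norm.
by rewrite pos_eq0 ?(ltW r0) // pos_id ?oppr_ge0 ?(ltW r0) // add0r ltr0_norm.
Qed.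
Lemma posBN r : pos r - pos (- r) = r.
Proof.
case: (lerP 0 r) => r0; first by rewrite pos_id // pos_eq0 ?oppr_le0 // subr0.
by rewrite pos_eq0 ?(ltW r0) // pos_id ?oppr_ge0 ?(ltW r0) // sub0r opprK.
Qed.
Lemma pos_neq0 r : pos r != 0 -> 0 < r.
Proof. by case: (lerP r 0) => // /pos_eq0 ->; rewrite eqxx. Qed.
(** Recovers the weights of two nonadjacent vertices from their difference. *)
Lemma posB r s : 0 <= r -> 0 <= s -> (r != 0 -> s = 0) -> pos (r - s) = r.
Proof.
move=> r0 s0; have [->|rN /(_ isT) ->] := eqVneq r 0; last by rewrite subr0 pos_id.
by move=> _; rewrite sub0r pos_eq0 // oppr_le0.
Qed.

(* The union of the cones with apices [inl 0] and [inl (i + 1)] is an l1-sphere. *)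
Definition branch (i : 'I_m.+1) (c : 'I_k.+1 -> R) : {ptws suspension_vertex -> R} :=
  fun a => match a with
  | inl j => if unlift ord0 j is Some j' then (if j' == i then pos (- c ord0) else 0)
             else pos (c ord0)
  | inr p => pos (if p.2 then c (lift ord0 p.1) else - c (lift ord0 p.1))
  end.

Lemma branch0 i c : branch i c (inl ord0) = pos (c ord0).
Proof. by rewrite /branch unlift_none. Qed.
Lemma branchS i c j : branch i c (inl (lift ord0 j)) = if j == i then pos (- c ord0) else 0.
Proof. by rewrite /branch liftK. Qed.

Lemma branch_ge0 i c a : 0 <= branch i c a.
Proof.
case: a => [j|p]; last exact: pos_ge0.
by case: (unliftP ord0 j) => [j' ->|->]; rewrite ?branchS ?branch0; [case: ifP|];
   rewrite ?pos_ge0.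
Qed.

Lemma sum_branch i c : \sum_a branch i c a = norm1 c.
Proof.
rewrite /norm1 big_sumType /= [RHS]big_ord_recl; congr (_ + _).
  rewrite big_ord_recl unlift_none; under eq_bigr do rewrite liftK.
  by rewrite -big_mkcond big_pred1_eq posDN.
rewrite -(pair_bigA _ (fun j b => pos (if b then c (lift ord0 j) else - c (lift ord0 j)))) /=.
by apply: eq_bigr => j _; rewrite big_bool /= posDN.
Qed.

(** Nonadjacent vertices never carry weight together. So at most one apex other than [inl ord0] is
    charged, which selects the branch, and each opposite pair is encoded by one signed
    coordinate. *)
Lemma suspensionP (x : {ptws suspension_vertex -> R}) :
  clique_complex R suspension_rel x <-> exists i c, norm1 c = 1 /\ x = branch i c.
Proof.
split=> [/clique_complexP[x0 x1 ex]|[i [c [c1 ->]]]]; last first.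
  apply/clique_complexP; split; [exact: branch_ge0|by rewrite sum_branch|].
  move=> [j|[j b]] [j'|[j' b']] //=; last first.
    move=> /pos_neq0 cj /pos_neq0 cj'; apply/implyP => /eqP jj'; subst j'.
    by move: cj cj'; case: b b' => [] [] //; lra.
  case: (unliftP ord0 j) => [l ->|->]; case: (unliftP ord0 j') => [l' ->|->] //;
    rewrite ?branchS ?branch0.
  - have [->|_] := eqVneq l i; rewrite ?eqxx //.
    by have [->|_] := eqVneq l' i; rewrite ?eqxx.
  - by case: (l == i); rewrite ?eqxx // => /pos_neq0 c0 /pos_neq0 c0'; lra.
  - by move=> /pos_neq0 c0; case: (l' == i); rewrite ?eqxx // => /pos_neq0 c0'; lra.
(* If no such apex is charged, the point lies in the cone shared by all branches, and the default
   index is as good as any. *)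
pose i := odflt ord0 [pick j | x (inl (lift ord0 j)) != 0].
have xi j : x (inl (lift ord0 j)) != 0 -> j = i.
  rewrite /i; case: pickP => [l xl|/(_ j) -> //] /= xj.
  by have /eqP/lift_inj := ex _ _ xj xl.
pose c (j : 'I_k.+1) := if unlift ord0 j is Some l then
  x (inr (l, true)) - x (inr (l, false)) else x (inl ord0) - x (inl (lift ord0 i)).
have xE : x = branch i c.
  apply/funext => -[j|[j b]].
    case: (unliftP ord0 j) => [l ->|->]; rewrite ?branchS ?branch0 /c unlift_none.
      have [->|li] := eqVneq l i; last first.
        by apply/eqP/negP => /negP/xi/eqP; rewrite (negPf li).
      rewrite opprB posB // => xi0; apply/eqP/negP => /negP x00.
      by have := ex _ _ xi0 x00.
    rewrite posB // => x00; apply/eqP/negP => /negP xi0.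
    by have := ex _ _ xi0 x00.
  rewrite /branch /c /= liftK; case: b.
    rewrite posB // => xt; apply/eqP/negP => /negP xf.
    by have := ex _ _ xt xf; rewrite /= eqxx.
  rewrite opprB posB // => xt; apply/eqP/negP => /negP xf.
  by have := ex _ _ xt xf; rewrite /= eqxx.
by exists i, c; rewrite -(sum_branch i) -xE.
Qed.

Arguments branch _ _ _ : simpl never.

(** * The maps between the join and the wedge, and their homotopies *)

Definition wedge_branch (i : 'I_m.+1) (c : 'I_k.+1 -> R) :
    {ptws 'I_m.+1 -> {ptws 'I_k.+1 -> R}} :=
  fun j => if j == i then c else sphere_pt R k.

Lemma sum_sqr_sphere_pt : \sum_i sphere_pt R k i ^+ 2 = 1.
Proof.
rewrite big_ord_recl {1}/sphere_pt /= expr1n big1 ?addr0 // => i _.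
by rewrite /sphere_pt /= expr0n.
Qed.

Lemma wedgeP (z : {ptws 'I_m.+1 -> {ptws 'I_k.+1 -> R}}) :
  wedge_spheres R m.+1 k z <->
  exists i c, \sum_j c j ^+ 2 = 1 /\ z = wedge_branch i c.
Proof.
split=> [[i [zi zN]]|[i [c [c1 ->]]]].
  exists i, (z i); split=> //; apply/funext => j; rewrite /wedge_branch.
  by have [->//|/zN] := eqVneq j i.
exists i; split; first by rewrite /wedge_branch eqxx.
by move=> j /negPf ji; rewrite /wedge_branch ji.
Qed.

Lemma wedge_sum_sqr z i : wedge_spheres R m.+1 k z -> \sum_j z i j ^+ 2 = 1.
Proof.
move=> /wedgeP[l [c [c1 ->]]]; rewrite /wedge_branch.
by case: eqP => // _; exact: sum_sqr_sphere_pt.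
Qed.

(* After normalization, this stretches the lower half of the l1-sphere onto the
   whole sphere, collapsing the upper half to the base point. *)
Definition stretch (c : 'I_k.+1 -> R) : 'I_k.+1 -> R := fun j =>
  if unlift ord0 j is Some _ then pos (- c ord0) * c j else 1 - 2 * pos (- c ord0).

Lemma stretch0 c : stretch c ord0 = 1 - 2 * pos (- c ord0).
Proof. by rewrite /stretch unlift_none. Qed.
Lemma stretchS c j : stretch c (lift ord0 j) = pos (- c ord0) * c (lift ord0 j).
Proof. by rewrite /stretch liftK. Qed.

(** The segment from [stretch c] to the multiple [l] of [c]. On the wedge side [c] is the
    l1-normalization of a point and [l] its norm, so the segment ends at that point; on the join
    side [l] is 1. *)
Definition push (t l : R) (c : 'I_k.+1 -> R) : 'I_k.+1 -> R :=
  fun j => (1 - t) * stretch c j + t * (l * c j).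

(** Beyond the first coordinate, the segment multiplies [c] by (1 - t) b + t l, where b is the
    negative part of [c ord0]. If this factor is 0, then t = b = 0 and the first coordinate is 1.
    Otherwise a zero would force [c] to be a pole; there [stretch c] equals [c], and a positive
    combination of the two cannot vanish. *)
Lemma push_neq0 t l c : 0 <= t <= 1 -> 0 < l -> norm1 c = 1 -> norm1 (push t l c) != 0.
Proof.
move=> /andP[t0 t1] l0 c1; apply/eqP => P0.
have {}P0 := norm1_eq0 P0.
have := P0 ord0; rewrite /push stretch0; set b := pos _ => P00.
have b0 : 0 <= b := pos_ge0 _.
have tl : 0 <= t * l by rewrite mulr_ge0 // ltW.
have [q0|q0] := eqVneq ((1 - t) * b + t * l) 0.
  have tb : 0 <= (1 - t) * b by rewrite mulr_ge0 //; lra.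
  have /eqP : t * l = 0 by lra.
  rewrite mulf_eq0 (gt_eqF l0) orbF => /eqP tE; rewrite tE in q0 P00.
  by lra.
have cS j : c (lift ord0 j) = 0.
  have := P0 (lift ord0 j); rewrite /push stretchS -/b => /eqP.
  rewrite !mulrA -mulrDl mulf_eq0 (negPf q0) => /eqP //.
have tl0 : t * l = 0 -> t = 0.
  by move=> /eqP; rewrite mulf_eq0 (gt_eqF l0) orbF => /eqP.
have : `|c ord0| = 1.
  by rewrite -c1 /norm1 big_ord_recl big1 ?addr0 // => j _; rewrite cS normr0.
move: P00; rewrite /b; have [c0|c0] := lerP 0 (c ord0).
  rewrite pos_eq0 ?oppr_le0 // ger0_norm // => + cE; rewrite cE => h.
  by have /tl0 tE : t * l = 0; [lra|rewrite tE in h; lra].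
rewrite pos_id ?oppr_ge0 ?(ltW c0) // ltr0_norm // => + cE.
have -> : c ord0 = -1 by lra.
by move=> h; have /tl0 tE : t * l = 0; [lra|rewrite tE in h; lra].
Qed.

Lemma norm1_stretch_neq0 c : norm1 c = 1 -> norm1 (stretch c) != 0.
Proof.
move=> c1; have := @push_neq0 0 1 c; rewrite lexx ler01 ltr01 => /(_ isT isT c1).
suff -> : push 0 1 c = stretch c by [].
by apply/funext => j; rewrite /push; ring.
Qed.

(** [stretch] and normalization on all branches at once: the weight of [inl (lift ord0 i)] plays the
    role of [pos (- c ord0)], and where it is 0 the i-th component is the base point. *)
Definition to_wedge (x : {ptws suspension_vertex -> R}) :
    {ptws 'I_m.+1 -> {ptws 'I_k.+1 -> R}} :=
  fun i => normalize2 (fun j => if unlift ord0 j is Some l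
    then x (inl (lift ord0 i)) * (x (inr (l, true)) - x (inr (l, false)))
    else 1 - 2 * x (inl (lift ord0 i))).

Lemma normalize2_sphere_pt : normalize2 (sphere_pt R k) = sphere_pt R k.
Proof. exact/normalize2_id/sum_sqr_sphere_pt. Qed.

Lemma to_wedge_branch i c : to_wedge (branch i c) = wedge_branch i (normalize2 (stretch c)).
Proof.
apply/funext => i'; rewrite /to_wedge /wedge_branch branchS.
have [_|_] := eqVneq i' i.
  congr normalize2; apply/funext => j; rewrite /stretch.
  by case: unliftP => [l ->|//]; rewrite /branch /= posBN.
rewrite -[RHS]normalize2_sphere_pt; congr normalize2; apply/funext => j.
by case: unliftP => [l ->|->]; rewrite /sphere_pt /= ?mul0r // mulr0 subr0.
Qed.

(** The fold map of the wedge onto one sphere, extended to the ambient space: the base point plus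
    the sum of all deviations from it. *)
Definition merge (z : {ptws 'I_m.+1 -> {ptws 'I_k.+1 -> R}}) : 'I_k.+1 -> R :=
  fun j => if unlift ord0 j is Some _ then \sum_i z i j else 1 + \sum_i (z i ord0 - 1).

Lemma merge_wedge_branch i c : merge (wedge_branch i c) = c.
Proof.
apply/funext => j; rewrite /merge; case: unliftP => [l ->|->].
  rewrite (bigD1 i) //= /wedge_branch eqxx big1 ?addr0 // => i' /negPf ->.
  by rewrite /sphere_pt.
rewrite (bigD1 i) //= /wedge_branch eqxx big1 => [|i' /negPf ->].
  by ring.
by rewrite /sphere_pt /= subrr.
Qed.

(** Carries the i-th sphere to the i-th branch and the base point to the apex [inl ord0]. The other
    apices use [z i ord0] instead of the merged coordinate: it is 1 at the base point, so inactive
    branches get weight 0. *)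
Definition of_wedge (z : {ptws 'I_m.+1 -> {ptws 'I_k.+1 -> R}}) :
    {ptws suspension_vertex -> R} :=
  fun a => match a with
  | inl j => if unlift ord0 j is Some i then pos (- (z i ord0 / norm1 (merge z)))
             else pos (normalize1 (merge z) ord0)
  | inr p => pos (if p.2 then normalize1 (merge z) (lift ord0 p.1)
                  else - normalize1 (merge z) (lift ord0 p.1))
  end.

Lemma of_wedge_branch i c : of_wedge (wedge_branch i c) = branch i (normalize1 c).
Proof.
apply/funext => a; rewrite /of_wedge merge_wedge_branch /branch; case: a => [j|//].
case: unliftP => // i' _; rewrite /wedge_branch; case: eqP => // _.
by rewrite /sphere_pt /= pos_eq0 // oppr_le0 divr_ge0 // norm1_ge0.
Qed.

(** [push] with [l] equal to 1, rewritten in barycentric coordinates. Only the active branch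
    contributes to [b], whereas each apex uses its own weight, so the apices of inactive branches
    keep weight 0. *)
Definition suspension_homotopy (p : R * {ptws suspension_vertex -> R}) :
    {ptws suspension_vertex -> R} :=
  let t := p.1 in let x := p.2 in
  let b := \sum_(i < m.+1) x (inl (lift ord0 i)) in
  let v (j : 'I_k.+1) := if unlift ord0 j is Some l
    then ((1 - t) * b + t) * (x (inr (l, true)) - x (inr (l, false)))
    else (1 - t) * (1 - 2 * b) + t * (x (inl ord0) - b) in
  fun a => match a with
  | inl j => if unlift ord0 j is Some i then
      pos (- (((1 - t) * (1 - 2 * x (inl (lift ord0 i)))
        + t * (x (inl ord0) - x (inl (lift ord0 i)))) / norm1 v))
      else pos (normalize1 v ord0)
  | inr p => pos (if p.2 then normalize1 v (lift ord0 p.1)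
                  else - normalize1 v (lift ord0 p.1))
  end.

Lemma suspension_homotopy_branch t i c : 0 <= t <= 1 ->
  suspension_homotopy (t, branch i c) = branch i (normalize1 (push t 1 c)).
Proof.
move=> /andP[t0 t1].
have bE : \sum_(i' < m.+1) branch i c (inl (lift ord0 i')) = pos (- c ord0).
  by under eq_bigr do rewrite branchS; rewrite -big_mkcond big_pred1_eq.
apply/funext => a; rewrite /suspension_homotopy /= bE.
set v := (fun j : 'I_k.+1 => _).
have -> : v = push t 1 c.
  apply/funext => j; rewrite /v /push; case: unliftP => [l ->|->].
    by rewrite stretchS /branch /= posBN; ring.
  by rewrite stretch0 branch0 posBN; ring.
case: a => [j|//]; rewrite [RHS]/branch; case: unliftP => // i' _.
rewrite branchS branch0; case: eqP => [_|_].
  by rewrite /normalize1 /push stretch0 mul1r posBN.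
rewrite pos_eq0 // oppr_le0 mulr0 !subr0 mulr1 divr_ge0 ?norm1_ge0 //.
by rewrite addr_ge0 ?mulr_ge0 ?pos_ge0 //; lra.
Qed.

(** Acts on each component separately; it stays in the wedge because [push] fixes the base point. *)
Definition wedge_homotopy (p : R * {ptws 'I_m.+1 -> {ptws 'I_k.+1 -> R}}) :
    {ptws 'I_m.+1 -> {ptws 'I_k.+1 -> R}} :=
  fun i => normalize2 (push p.1 (norm1 (p.2 i)) (normalize1 (p.2 i))).

Lemma norm1_sphere_pt : norm1 (sphere_pt R k) = 1.
Proof.
rewrite /norm1 big_ord_recl big1 ?addr0 /sphere_pt /= ?normr1 // => i _.
by rewrite normr0.
Qed.

Lemma push_sphere_pt t : push t 1 (sphere_pt R k) = sphere_pt R k.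
Proof.
apply/funext => j; rewrite /push; case: (unliftP ord0 j) => [l ->|->].
  by rewrite stretchS /sphere_pt /=; ring.
by rewrite stretch0 /sphere_pt /= pos_eq0 ?oppr_le0 ?ler01 //; ring.
Qed.

Lemma wedge_homotopy_branch t i c : wedge_homotopy (t, wedge_branch i c) =
  wedge_branch i (normalize2 (push t (norm1 c) (normalize1 c))).
Proof.
apply/funext => j; rewrite /wedge_homotopy /wedge_branch /=; case: eqP => // _.
rewrite norm1_sphere_pt normalize1_id ?norm1_sphere_pt //.
by rewrite push_sphere_pt normalize2_sphere_pt.
Qed.

Section Limits.
Context (T : Type) (F : set_system T) {FF : Filter F}.

Lemma cvg_pos (f : T -> R) (l : R) : f @ F --> l -> pos (f t) @[t --> F] --> pos l.
Proof. by move=> fl; apply: cvg_max => //; exact: cvg_cst. Qed.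

Lemma cvg_stretch (f : T -> 'I_k.+1 -> R) (l : 'I_k.+1 -> R) :
  (forall j, f t j @[t --> F] --> l j) ->
  forall j, stretch (f t) j @[t --> F] --> stretch l j.
Proof.
move=> fl j; rewrite /stretch; have fl0 : pos (- f t ord0) @[t --> F] --> pos (- l ord0).
  by apply: cvg_pos; apply: cvgN; exact: fl.
case: (unlift ord0 j) => [_|]; first by apply: cvgM => //; exact: fl.
by apply: cvgB; [exact: cvg_cst|exact: cvgMl_tmp].
Qed.

End Limits.

(** On each branch both composites are [stretch] up to normalization, and the segment [push] deforms
    this to the identity without meeting 0. *)
Theorem suspension_wedge_spheres :
  homotopy_equivalent R (clique_complex R suspension_rel) (wedge_spheres R m.+1 k).
Proof.
have to_wedgeP x : clique_complex R suspension_rel x -> wedge_spheres R m.+1 k (to_wedge x).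
  move=> /suspensionP[i [c [c1 ->]]]; rewrite to_wedge_branch; apply/wedgeP.
  by exists i, (normalize2 (stretch c)); rewrite sum_sqr_normalize2 // norm1_stretch_neq0.
have of_wedgeP z : wedge_spheres R m.+1 k z -> clique_complex R suspension_rel (of_wedge z).
  move=> /wedgeP[i [c [c1 ->]]]; rewrite of_wedge_branch; apply/suspensionP.
  by exists i, (normalize1 c); rewrite norm1_normalize1 // norm1_sphere_neq0.
exists to_wedge, of_wedge; split.
  apply/subspace_continuousP => x ex; apply: cvg_ptws => i; apply: cvg_ptws => j.
  have cx a : y a @[y --> within (clique_complex R suspension_rel) (nbhs x)] --> x a.
    by apply: (@cvg_proj _ _ _ _ _ id); apply: cvg_within.
  apply: cvg_normalize2 => [l|].
    case: (unlift ord0 l) => [l'|]; first by apply: cvgM => //; exact: cvgB.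
    by apply: cvgB; [exact: cvg_cst|exact: cvgMl_tmp].
  exact: norm1_normalize2_neq0 (wedge_sum_sqr i (to_wedgeP _ ex)).
split; first by apply/image_subP.
split.
  apply/subspace_continuousP => z wz; have wz' := wz; apply: cvg_ptws => a.
  have cz i j : y i j @[y --> within (wedge_spheres R m.+1 k) (nbhs z)] --> z i j.
    have czi : y i @[y --> within (wedge_spheres R m.+1 k) (nbhs z)] --> z i.
      by apply: (@cvg_proj _ _ _ _ _ id); exact: cvg_within.
    exact: (@cvg_proj _ _ _ _ _ (fun y => y i)).
  have cm j : merge y j @[y --> within (wedge_spheres R m.+1 k) (nbhs z)] --> merge z j.
    rewrite /merge; case: (unlift ord0 j) => [_|]; first exact: cvg_sumr.
    apply: cvgD; first exact: cvg_cst.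
    by apply: cvg_sumr => i _; apply: cvgB => //; exact: cvg_cst.
  have m0 : norm1 (merge z) != 0.
    by case/wedgeP: wz' => [i [c [c1 ->]]]; rewrite merge_wedge_branch norm1_sphere_neq0.
  suff : of_wedge y a @[y --> within (wedge_spheres R m.+1 k) (nbhs z)] --> of_wedge z a by [].
  rewrite /of_wedge; case: a => [j|[j b]].
    case: (unlift ord0 j) => [i|]; apply: cvg_pos; last exact: (cvg_normalize1 cm m0).
    exact: (cvgN (cvg_divr m0 (cz i ord0) (cvg_norm1 cm))).
  by apply: cvg_pos; case: b => /=; [|apply: cvgN]; exact: (cvg_normalize1 cm m0).
split; first by apply/image_subP.
split.
  exists suspension_homotopy; split; last split=> [t x t01|]; last split=> x.
  - apply/subspace_continuousP => -[t x] [/= t01 ex]; apply: cvg_ptws => a.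
    set G := within _ _.
    have cx b : p.2 b @[p --> G] --> x b.
      by apply: cvg_proj; apply: cvg_within_filter; exact: cvg_snd.
    have ct : p.1 @[p --> G] --> t by apply: cvg_within_filter; exact: cvg_fst.
    have c1t : 1 - p.1 @[p --> G] --> 1 - t by apply: cvgB => //; exact: cvg_cst.
    have cb : \sum_(i < m.+1) p.2 (inl (lift ord0 i)) @[p --> G] -->
        \sum_(i < m.+1) x (inl (lift ord0 i)) by exact: cvg_sumr.
    pose v (p : R * {ptws suspension_vertex -> R}) (j : 'I_k.+1) :=
      if unlift ord0 j is Some l
      then ((1 - p.1) * (\sum_(i < m.+1) p.2 (inl (lift ord0 i))) + p.1) *
        (p.2 (inr (l, true)) - p.2 (inr (l, false)))
      else (1 - p.1) * (1 - 2 * (\sum_(i < m.+1) p.2 (inl (lift ord0 i)))) +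
        p.1 * (p.2 (inl ord0) - (\sum_(i < m.+1) p.2 (inl (lift ord0 i)))).
    have c12 f (l : R) : f @ G --> l -> 1 - 2 * f p @[p --> G] --> 1 - 2 * l.
      by move=> fl; apply: cvgB; [exact: cvg_cst|exact: cvgMl_tmp].
    have cv j : v p j @[p --> G] --> v (t, x) j.
      rewrite /v; case: (unlift ord0 j) => [l|].
        by apply: cvgM; [apply: cvgD => //; exact: cvgM|exact: cvgB].
      by apply: cvgD; apply: cvgM => //; [exact: c12|exact: cvgB].
    (* If the norm were 0, division by zero would return 0 in every coordinate, but by the branch
       formula the coordinates sum to 1. *)
    have v0 : norm1 (v (t, x)) != 0.
      apply/eqP => v0; have := suspension_homotopy_branch; case/suspensionP: ex => i [c [c1 xE]].
      move=> /(_ t i c t01) Kt.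
      have : norm1 (normalize1 (push t 1 c)) = 1.
        by rewrite norm1_normalize1 // push_neq0 // ltr01.
      rewrite -(sum_branch i) -Kt -xE big1 => [/eqP|a' _]; first by rewrite eq_sym oner_eq0.
      rewrite /suspension_homotopy -[X in norm1 X]/(v (t, x)) -/(v (t, x)).
      by case: a' => [j|[j []]] /=; [case: (unlift ord0 j) => [?|]| |];
        rewrite /normalize1 v0 invr0 mulr0 ?oppr0 pos0.
    suff : suspension_homotopy p a @[p --> G] --> suspension_homotopy (t, x) a by [].
    rewrite /suspension_homotopy; case: a => [j|[j b]].
      case: (unlift ord0 j) => [i|]; apply: cvg_pos; last exact: (cvg_normalize1 cv v0).
      apply: (cvgN (cvg_divr v0 _ (cvg_norm1 cv))).
      by apply: cvgD; apply: cvgM => //; [exact: c12|exact: cvgB].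
    by apply: cvg_pos; case: b => /=; [|apply: cvgN]; exact: (cvg_normalize1 cv v0).
  - move=> /suspensionP[i [c [c1 ->]]]; rewrite suspension_homotopy_branch //.
    apply/suspensionP; exists i, (normalize1 (push t 1 c)); split=> //.
    by rewrite norm1_normalize1 // push_neq0 // ltr01.
  - move=> /suspensionP[i [c [c1 ->]]]; rewrite suspension_homotopy_branch ?lexx ?ler01 //.
    rewrite /= to_wedge_branch of_wedge_branch normalize1_normalize2 ?norm1_stretch_neq0 //.
    by congr branch; congr normalize1; apply/funext => j; rewrite /push; ring.
  - move=> /suspensionP[i [c [c1 ->]]]; rewrite suspension_homotopy_branch ?lexx ?ler01 //.
    have -> : push 1 1 c = c by apply/funext => j; rewrite /push; ring.
    by rewrite normalize1_id.
have push_sphere_neq0 t c : 0 <= t <= 1 -> \sum_j c j ^+ 2 = 1 ->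
    norm1 (push t (norm1 c) (normalize1 c)) != 0.
  move=> t01 /norm1_sphere_neq0 c0; apply: push_neq0 => //; last exact: norm1_normalize1.
  by rewrite lt0r c0 norm1_ge0.
exists wedge_homotopy; split; last split=> [t z t01|]; last split=> z.
- apply/subspace_continuousP => -[t z] [/= t01 wz]; apply: cvg_ptws => i; apply: cvg_ptws => j.
  set G := within _ _.
  have cz l : p.2 i l @[p --> G] --> z i l.
    have czi : p.2 i @[p --> G] --> z i.
      by apply: cvg_proj; apply: cvg_within_filter; exact: cvg_snd.
    exact: (@cvg_proj _ _ _ _ _ (fun p => p.2 i)).
  have ct : p.1 @[p --> G] --> t by apply: cvg_within_filter; exact: cvg_fst.
  have zi := wedge_sum_sqr i wz.
  have z0 := norm1_sphere_neq0 zi.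
  have cn l : normalize1 (p.2 i) l @[p --> G] --> normalize1 (z i) l.
    exact: (cvg_normalize1 cz z0).
  apply: cvg_normalize2 => [l|]; last exact: push_sphere_neq0.
  apply: cvgD; apply: cvgM => //.
  + by apply: cvgB => //; exact: cvg_cst.
  + exact: (cvg_stretch cn).
  + by apply: cvgM; [exact: (cvg_norm1 cz)|exact: cn].
- move=> /wedgeP[i [c [c1 ->]]]; rewrite wedge_homotopy_branch; apply/wedgeP.
  by exists i; eexists; split; last reflexivity; rewrite sum_sqr_normalize2 // push_sphere_neq0.
- move=> /wedgeP[i [c [c1 ->]]]; rewrite wedge_homotopy_branch /= of_wedge_branch to_wedge_branch.
  congr wedge_branch; congr normalize2; apply/funext => j; rewrite /push; ring.
- move=> /wedgeP[i [c [c1 ->]]]; rewrite wedge_homotopy_branch; congr wedge_branch.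
  rewrite -[RHS](normalize2_id c1); congr normalize2; apply/funext => j; rewrite /push /normalize1.
  by field; exact: norm1_sphere_neq0.
Qed.

End Suspension.

Lemma wedge1_sphere (R : realType) (k : nat) :
  homotopy_equivalent R (wedge_spheres R 1 k) (sphere R k).
Proof.
pose f (z : {ptws 'I_1 -> {ptws 'I_k.+1 -> R}}) := z ord0.
pose g (c : {ptws 'I_k.+1 -> R}) : {ptws 'I_1 -> {ptws 'I_k.+1 -> R}} := fun=> c.
apply: (@homeomorphic_homotopy_equivalent R _ _ _ _ f g).
- apply/subspace_continuousP => z _.
  by apply: (@cvg_proj _ _ _ _ _ id); exact: cvg_within.
- by move=> z [i]; rewrite (ord1 i) => -[].
- apply/subspace_continuousP => c _; apply: cvg_ptws => i; exact: cvg_within.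
- by move=> c c1; exists ord0; split=> // j; rewrite ord1.
- by move=> z _; apply/funext => i; rewrite (ord1 i).
- by [].
Qed.

(** * Certified sequences of moves on adjacency matrices *)

Section Certificates.
Local Open Scope nat_scope.
Variable R : realType.

Definition entry (M : seq (seq bool)) (u v : nat) : bool := nth false (nth [::] M u) v.

Definition set_entry (M : seq (seq bool)) (u v : nat) (b : bool) : seq (seq bool) :=
  set_nth [::] M u (set_nth false (nth [::] M u) v b).

Definition set_pair (M : seq (seq bool)) (u v : nat) (b : bool) : seq (seq bool) :=
  set_entry (set_entry M u v b) v u b.

Lemma entry_set_pair M u v b x y : entry (set_pair M u v b) x y =
  if ((x == u) && (y == v)) || ((x == v) && (y == u)) then b else entry M x y.
Proof.
have set_entryE N u' v' : entry (set_entry N u' v' b) x y =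
    if (x == u') && (y == v') then b else entry N x y.
  rewrite /entry /set_entry nth_set_nth /=; case: (x =P u') => [->|//] /=.
  by rewrite nth_set_nth.
rewrite /set_pair !set_entryE orbC.
by case: (_ && _) => //; case: (_ && _).
Qed.

(* The vertex x is present in the complex iff the diagonal entry (x, x) is true. *)
Definition matrix_rel (N : nat) (M : seq (seq bool)) : rel 'I_N := fun x y => entry M x y.

(** The test is made on [M1], where the pair is present, so it is the same for removing the pair and
    for adding it. *)
Definition toggle_ok (N : nat) (M : seq (seq bool)) (u v w : nat) : bool :=
  let M1 := set_pair M u v true in
  [&& u < N, v < N, w < N, w != u, w != v &
    entry M1 u u && entry M1 v v ==> entry M1 w w &&
      all (fun z => [&& entry M1 z z, entry M1 u z & entry M1 v z] ==>
        entry M1 z w && entry M1 w z) (iota 0 N)].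

Fixpoint toggles (N : nat) (M : seq (seq bool)) (l : seq (nat * nat * nat)) :
    option (seq (seq bool)) :=
  if l is (u, v, w) :: l' then
    if toggle_ok N M u v w then toggles N (set_pair M u v (~~ entry M u v)) l' else None
  else Some M.

Lemma toggle_homotopy_equivalent N M u v w b : toggle_ok N M u v w ->
  homotopy_equivalent R (clique_complex R (@matrix_rel N M))
    (clique_complex R (@matrix_rel N (set_pair M u v b))).
Proof.
rewrite /toggle_ok; set M1 := set_pair M u v true.
case/and5P=> uN vN wN wu /andP[wv /implyP cone].
pose M0 := set_pair M u v false.
have M10 : homotopy_equivalent R (clique_complex R (@matrix_rel N M1))
    (clique_complex R (@matrix_rel N M0)).
  apply: (@clique_complex_remove_pair R _ _ _ (Ordinal uN) (Ordinal vN) (Ordinal wN)) => //.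
  - move=> a c; rewrite /matrix_rel !entry_set_pair -!val_eqE /=.
    by case: (_ || _); rewrite ?andbF ?andbT.
  - by move=> u1 v1; have /andP[] := cone (introT andP (conj u1 v1)).
  - move=> z u1 v1 z1 uz vz.
    have /andP[_ /allP /(_ (val z))] := cone (introT andP (conj u1 v1)).
    rewrite mem_iota /= add0n ltn_ord => /(_ isT)/implyP; apply.
    by apply/and3P.
have M01 := homotopy_equivalent_sym M10.
(* A simplex containing u and v needs both entries. If either entry is false, no point charges both
   vertices, so the complex of [M] is that of [M0]. *)
have : clique_complex R (@matrix_rel N M) = clique_complex R (@matrix_rel N M1) \/
    clique_complex R (@matrix_rel N M) = clique_complex R (@matrix_rel N M0).
  have [/andP[uv vu]|uv] := boolP (entry M u v && entry M v u).
    left; congr clique_complex; apply/funext => x; apply/funext => y.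
    rewrite /matrix_rel entry_set_pair; case: ifP => //.
    by case/orP=> /andP[/eqP -> /eqP ->].
  right; apply/seteqP; split=> x /clique_complexP[x0 x1 ex]; apply/clique_complexP;
    split=> // a c xa xc; have := ex _ _ xa xc; rewrite /matrix_rel entry_set_pair.
    case: ifP => // /orP[]/andP[/eqP au /eqP cv] ac; move: uv;
      by have := ex _ _ xc xa; rewrite /matrix_rel -au -cv => ->; rewrite ac.
  by case: ifP.
by case=> ->; case: b => //; exact: homotopy_equivalent_refl.
Qed.

Lemma toggles_homotopy_equivalent N M l M' : toggles N M l = Some M' ->
  homotopy_equivalent R (clique_complex R (@matrix_rel N M))
    (clique_complex R (@matrix_rel N M')).
Proof.
elim: l M => [|[[u v] w] l IH] M /=; first by case=> ->; exact: homotopy_equivalent_refl.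
case: ifP => // ok /IH; apply: homotopy_equivalent_trans.
exact: toggle_homotopy_equivalent ok.
Qed.

(** * Matrices of the torus complexes and recognition of the join *)

Definition torus_matrix (n r : nat) : seq (seq bool) :=
  mkseq (fun a => mkseq (fun b =>
    cycdist n (a %/ n) (b %/ n) + cycdist n (a %% n) (b %% n) <= r) (n * n)) (n * n).

Lemma torus_matrix_homotopy_equivalent n r : 0 < n ->
  homotopy_equivalent R (realization R (VR_simplex (@torus_dist n) r))
    (clique_complex R (@matrix_rel (n * n) (torus_matrix n r))).
Proof.
move=> n0.
have div_lt (a : 'I_(n * n)) : a %/ n < n by rewrite ltn_divLR.
have mod_lt (a : 'I_(n * n)) : a %% n < n by rewrite ltn_pmod.
have code_lt (v : 'I_n * 'I_n) : v.1 * n + v.2 < n * n.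
  by have := ltn_ord v.1; have := ltn_ord v.2; nia.
(* [VR_simplex] is convertible to the clique predicate of the relation of being at distance at most
   r. *)
apply: (@clique_complex_reindex R _ _ (fun a => (Ordinal (div_lt a), Ordinal (mod_lt a)))
  (fun x y => torus_dist x y <= r)).
- move=> a b [ab1 ab2]; apply/val_inj.
  by rewrite /= (divn_eq a n) (divn_eq b n) ab1 ab2.
- by move=> a b; rewrite /matrix_rel /entry /torus_matrix !nth_mkseq.
- move=> v _; exists (Ordinal (code_lt v)); case: v (code_lt v) => i j /= ij.
  congr pair; apply/val_inj; rewrite /=.
    by rewrite divnMDl // divn_small ?addn0.
  by rewrite modnMDl modn_small.
Qed.

(* [inl i] is numbered i and [inr (j, b)] is numbered m + 2 + 2 j + b. *)
Definition suspension_nat_rel (m x y : nat) : bool :=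
  if x < m.+2 then (y < m.+2) ==> (x == y)
  else (y < m.+2) || (((x - m.+2)./2 == (y - m.+2)./2) ==> (x == y)).

(** [s] lists the surviving vertices: the discrete points, then the opposite pairs side by side. The
    comparison includes the diagonal, so it also verifies that the listed vertices are present. *)
Definition suspension_ok (m k N : nat) (M : seq (seq bool)) (s : seq nat) : bool :=
  [&& uniq s, size s == m.+2 + k.*2, all (fun x => x < N) s,
    all (fun v => entry M v v ==> (v \in s)) (iota 0 N) &
    all (fun x => all (fun y =>
      entry M (nth 0 s x) (nth 0 s y) == suspension_nat_rel m x y) (iota 0 (size s)))
      (iota 0 (size s))].

Lemma suspension_homotopy_equivalent m k N M s : suspension_ok m k N M s ->
  homotopy_equivalent R (clique_complex R (@matrix_rel N M))
    (clique_complex R (@suspension_rel m k)).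
Proof.
case/and5P=> us /eqP sz /allP sN /allP alive /allP rel_ok.
pose code (a : suspension_vertex m k) : nat :=
  match a with inl i => i | inr (j, b) => m.+2 + (j.*2 + b) end.
have code_lt a : code a < size s.
  rewrite sz; case: a => [i|[j b]] /=; first by have := ltn_ord i; lia.
  by have := ltn_ord j; case: b => /=; lia.
have code_inj : injective code.
  move=> [i|[j b]] [i'|[j' b']] /= h.
  - by congr inl; apply/val_inj.
  - by have := ltn_ord i; lia.
  - by have := ltn_ord i'; lia.
  - have jj : j = j' by apply/val_inj => /=; case: b b' h => [] [] /=; lia.
    by move: h; rewrite jj; case: b; case: b' => //=; lia.
have code_rel a b : suspension_rel a b = suspension_nat_rel m (code a) (code b).
  rewrite /suspension_nat_rel; case: a b => [i|[j b]] [i'|[j' b']] /=.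
  - by rewrite !ltn_ord.
  - by rewrite ltn_ord ltnNge leq_addr.
  - by rewrite ltn_ord ltnNge leq_addr.
  - rewrite !ltnNge !leq_addr /= !addKn !(addnC _.*2) !half_bit_double eqn_add2l.
    rewrite -val_eqE /=; case: eqP => //= ->; rewrite eqn_add2r.
    by case: b b' => [] [].
have sN' a : nth 0 s (code a) < N by apply: sN; rewrite mem_nth.
apply: (@clique_complex_reindex R _ _ (fun a => Ordinal (sN' a))).
- by move=> a b [] /eqP; rewrite nth_uniq // => /eqP /code_inj.
- move=> a b; rewrite code_rel /matrix_rel /=.
  have := rel_ok (code a); rewrite mem_iota /= add0n => /(_ (code_lt a)).
  by move=> /allP/(_ (code b)); rewrite mem_iota /= add0n => /(_ (code_lt b))/eqP.
- move=> v vv; have := alive v; rewrite mem_iota /= add0n ltn_ord => /(_ isT)/implyP/(_ vv) vs.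
  (* Decoding an index from [m.+2] on: after subtraction, its half is the axis and its parity the
     end of that axis. *)
  have [a ca] : exists a, code a = index (val v) s.
    have := vs; rewrite -index_mem sz; set x := index _ _ => xlt.
    have [xm|xm] := ltnP x m.+2; first by exists (inl (Ordinal xm)).
    have xk : (x - m.+2)./2 < k by lia.
    exists (inr (Ordinal xk, odd (x - m.+2))) => /=.
    by rewrite addnC [_ + odd _]addnC odd_double_half subnK.
  by exists a; apply/val_inj; rewrite /= ca nth_index.
Qed.

Definition torus_certificate (n r m k : nat) (l : seq (nat * nat * nat)) (s : seq nat) : bool :=
  if toggles (n * n) (torus_matrix n r) l is Some M
  then suspension_ok m k (n * n) M s else false.

Lemma torus_VR_homotopy_equivalent n r m k l s : 0 < n -> torus_certificate n r m k l s ->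
  homotopy_equivalent R (realization R (VR_simplex (@torus_dist n) r))
    (wedge_spheres R m.+1 k).
Proof.
move=> n0; rewrite /torus_certificate.
case E: (toggles _ _ _) => [M|//] sok.
apply: homotopy_equivalent_trans (torus_matrix_homotopy_equivalent r n0) _.
apply: homotopy_equivalent_trans (toggles_homotopy_equivalent E) _.
apply: homotopy_equivalent_trans (suspension_homotopy_equivalent sok) _.
exact: suspension_wedge_spheres.
Qed.

End Certificates.

(* Each triple (u, v, w) toggles the pair {u, v} (a vertex if u = v), the link of
   which is a cone with apex w.  The sequences were found by random search. *)
Definition torus5_toggles : seq (nat * nat * nat) := [::
   (0, 3, 4); (4, 19, 24); (4, 14, 9); (0, 4, 1); (5, 7, 6); (15, 17, 16); (17, 19, 18);
    (0, 21, 16); (6, 21, 1); (0, 6, 11); (22, 24, 23); (21, 24, 20); (7, 17, 12);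
    (6, 16, 11); (4, 24, 9); (6, 7, 8); (2, 4, 3); (3, 18, 23); (16, 19, 15);
    (0, 15, 20); (6, 9, 5); (3, 7, 23); (3, 13, 8); (3, 4, 1); (4, 5, 10); (21, 23, 22);
    (6, 7, 8); (4, 8, 7); (6, 8, 12); (6, 16, 11); (4, 8, 7); (4, 20, 15); (5, 8, 9);
    (6, 21, 1); (7, 9, 8); (9, 19, 14); (3, 8, 23); (0, 5, 20); (4, 14, 13); (0, 4, 8);
    (7, 20, 16); (8, 18, 13); (11, 13, 12); (0, 16, 20); (3, 24, 20); (10, 13, 14);
    (8, 13, 23); (0, 12, 8); (7, 8, 0); (17, 18, 16); (19, 24, 14); (8, 16, 17);
    (17, 24, 16); (13, 18, 23); (8, 11, 12); (11, 24, 20); (13, 17, 12); (0, 24, 9);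
    (11, 17, 6); (8, 17, 12); (17, 22, 1); (5, 17, 6); (10, 17, 5); (9, 17, 3);
    (17, 21, 1); (17, 19, 3); (3, 14, 17); (8, 19, 0); (3, 9, 1); (6, 17, 5);
    (18, 19, 15); (3, 11, 21); (19, 21, 11); (14, 21, 10); (10, 19, 11); (13, 21, 6);
    (11, 17, 5); (6, 14, 21); (13, 19, 12); (7, 19, 0); (5, 17, 11); (6, 6, 21);
    (4, 8, 0); (5, 19, 11); (3, 7, 22); (1, 5, 11); (3, 21, 2); (3, 5, 2); (5, 20, 11);
    (3, 14, 19); (17, 19, 3); (20, 21, 11); (7, 8, 12); (5, 15, 14); (12, 21, 16);
    (18, 24, 20); (10, 18, 14); (7, 24, 16); (8, 22, 1); (4, 8, 0); (3, 9, 17);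
    (1, 19, 22); (8, 16, 7); (1, 17, 2); (3, 19, 7); (8, 15, 9); (5, 23, 13);
    (5, 10, 11); (15, 17, 14); (0, 22, 1); (10, 20, 11); (2, 21, 16); (10, 16, 11);
    (10, 23, 8); (19, 22, 1); (3, 22, 1); (3, 17, 9); (14, 17, 15); (10, 18, 14);
    (4, 12, 23); (17, 24, 20); (17, 20, 24); (10, 19, 12); (5, 21, 14); (13, 24, 23);
    (12, 19, 10); (17, 18, 12); (8, 20, 23); (8, 24, 23); (12, 17, 18); (6, 12, 0);
    (3, 6, 0); (18, 19, 14); (11, 22, 16); (2, 13, 12); (0, 19, 7); (4, 11, 10);
    (0, 15, 9); (2, 3, 1); (1, 17, 24); (8, 11, 0); (5, 7, 16); (0, 0, 8); (10, 21, 4);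
    (17, 24, 1); (3, 15, 9); (16, 19, 20); (11, 13, 14); (14, 21, 11); (4, 5, 12);
    (2, 8, 1); (3, 9, 15); (5, 13, 12); (21, 23, 22); (22, 22, 23); (17, 19, 15);
    (12, 13, 14); (19, 20, 16); (2, 19, 16); (19, 21, 16); (16, 17, 19); (17, 20, 9);
    (12, 17, 9); (17, 24, 1); (13, 19, 16); (8, 21, 1); (2, 16, 7); (2, 15, 17);
    (5, 16, 7); (1, 4, 8); (2, 4, 12); (3, 4, 12); (8, 10, 12); (16, 21, 19);
    (4, 16, 14); (9, 13, 4); (1, 13, 19); (9, 17, 2); (0, 24, 1); (3, 24, 20);
    (5, 15, 9); (2, 6, 0); (13, 14, 16); (3, 20, 24); (8, 13, 21); (17, 17, 2);
    (5, 12, 4); (16, 24, 20); (8, 24, 20); (1, 5, 2); (13, 20, 1); (13, 19, 1);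
    (13, 21, 8); (1, 13, 20); (2, 24, 1); (6, 23, 0); (4, 24, 14); (5, 6, 0);
    (5, 14, 4); (6, 8, 0); (3, 16, 12); (7, 17, 0); (4, 19, 18); (9, 9, 15);
    (18, 21, 4); (7, 9, 0); (2, 14, 18); (20, 24, 8); (10, 17, 0); (3, 19, 16);
    (13, 19, 4); (18, 18, 14); (9, 12, 0); (13, 21, 4); (4, 17, 0); (12, 16, 3);
    (4, 16, 19); (12, 14, 4); (3, 5, 24); (14, 24, 4); (2, 24, 5); (4, 13, 21);
    (6, 10, 0); (3, 13, 16); (8, 16, 20); (16, 19, 3); (2, 9, 0); (2, 5, 24);
    (2, 16, 20); (4, 16, 14); (20, 20, 16); (10, 14, 4); (6, 6, 8); (8, 14, 4);
    (13, 14, 3); (3, 13, 14); (6, 19, 21); (2, 14, 4); (3, 14, 4); (21, 21, 6);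
    (1, 13, 6); (9, 24, 0); (5, 16, 3); (8, 13, 1); (8, 9, 0); (6, 8, 16); (1, 14, 13);
    (10, 14, 19); (13, 13, 1); (0, 8, 1); (0, 10, 1); (13, 24, 0); (16, 17, 0);
    (0, 19, 1); (10, 16, 14); (9, 14, 0); (5, 24, 3); (14, 14, 10); (2, 17, 0);
    (0, 0, 2); (9, 19, 0); (8, 14, 0); (5, 19, 3); (5, 9, 0); (4, 13, 0); (9, 9, 19);
    (6, 13, 0); (9, 16, 10); (3, 19, 5); (0, 5, 19); (0, 6, 19); (3, 13, 0);
    (10, 19, 9); (6, 12, 0); (9, 10, 16); (3, 5, 16); (14, 24, 0); (19, 19, 0);
    (13, 13, 3); (0, 13, 24); (3, 24, 13); (5, 12, 0); (9, 12, 0); (17, 17, 10);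
    (12, 17, 10); (3, 13, 16); (13, 14, 0); (0, 5, 12); (13, 24, 0); (12, 13, 0);
    (10, 24, 17); (0, 6, 12); (0, 13, 12); (0, 9, 12); (0, 0, 2); (10, 14, 0);
    (14, 14, 8); (10, 17, 16); (8, 24, 14); (0, 12, 1); (8, 14, 16); (0, 0, 24);
    (0, 12, 2); (0, 17, 24); (24, 24, 0); (12, 17, 0); (12, 14, 0); (0, 0, 12)].

(** Ten discrete points, then the opposite pairs {1, 4}, {7, 15}, {11, 23}, {12, 16}. *)
Definition torus5_vertices : seq nat := [::
   2; 3; 5; 6; 8; 9; 10; 13; 14; 17; 1; 4; 7; 15; 11; 23; 12; 16].

(** Here no vertex returns: each of the 41 discarded vertices is toggled exactly once. *)
Definition torus7_toggles : seq (nat * nat * nat) := [::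
   (25, 41, 33); (1, 38, 44); (4, 41, 47); (1, 48, 0); (1, 41, 42); (20, 32, 26);
    (29, 48, 35); (12, 41, 48); (1, 20, 7); (16, 38, 31); (25, 37, 31); (34, 46, 40);
    (12, 42, 6); (32, 48, 40); (13, 46, 5); (36, 46, 45); (37, 46, 45); (1, 28, 43);
    (25, 28, 26); (1, 35, 43); (1, 47, 0); (12, 48, 6); (0, 16, 8); (19, 34, 27);
    (0, 46, 5); (1, 1, 9); (0, 12, 6); (28, 45, 36); (22, 41, 28); (25, 29, 24);
    (2, 35, 43); (5, 32, 39); (43, 46, 44); (5, 17, 11); (12, 12, 18); (41, 44, 35);
    (42, 46, 45); (25, 25, 18); (31, 43, 37); (40, 43, 42); (22, 38, 30); (3, 37, 44);
    (13, 33, 20); (18, 34, 26); (4, 37, 45); (37, 48, 36); (41, 43, 35); (32, 32, 31);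
    (24, 34, 28); (0, 3, 6); (26, 38, 39); (34, 34, 35); (13, 40, 6); (39, 43, 44);
    (31, 47, 39); (37, 47, 45); (13, 13, 7); (38, 38, 45); (48, 48, 6); (4, 42, 5);
    (47, 47, 6); (2, 39, 45); (2, 2, 9); (5, 5, 6); (43, 43, 8); (0, 10, 8);
    (3, 42, 36); (9, 42, 8); (4, 4, 11); (0, 11, 6); (3, 36, 44); (0, 9, 8); (0, 0, 28);
    (6, 15, 7); (42, 42, 28); (15, 15, 23); (7, 44, 8); (31, 36, 29); (22, 22, 23);
    (44, 44, 45); (37, 37, 30); (9, 36, 8); (10, 10, 18); (11, 11, 18); (3, 3, 18);
    (20, 20, 21); (7, 7, 14); (29, 29, 30); (9, 9, 18); (46, 46, 33); (14, 14, 21);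
    (19, 19, 27); (17, 17, 18); (23, 23, 30); (21, 21, 27); (35, 35, 28); (16, 16, 24);
    (36, 36, 28); (41, 41, 28); (31, 31, 24); (39, 39, 33); (24, 24, 30); (33, 33, 40);
    (26, 26, 27)].

(** The two suspension points 6 and 30, then the opposite pairs {8, 40}, {18, 28}, {27, 45} of the
    octahedron. *)
Definition torus7_vertices : seq nat := [::
   6; 30; 8; 40; 18; 28; 27; 45].

(** * Evaluation of the certificates and conclusion *)

(** The parameters 8 and 4 stand for [8.+2] points and 4 axes, hence [8.+1] spheres of dimension
    4. *)
Lemma torus5_certificate : torus_certificate 5 3 8 4 torus5_toggles torus5_vertices.
Proof. by vm_compute. Qed.

Lemma torus7_certificate : torus_certificate 7 4 0 3 torus7_toggles torus7_vertices.
Proof. by vm_compute. Qed.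

Theorem theorem7p1 (R : realType) :
  homotopy_equivalent R
    (realization R (VR_simplex (@torus_dist 5) 3)) (wedge_spheres R 9 4) /\
  homotopy_equivalent R
    (realization R (VR_simplex (@torus_dist 7) 4)) (sphere R 3).
Proof.
split; first exact: (torus_VR_homotopy_equivalent R _ torus5_certificate).
apply: homotopy_equivalent_trans (wedge1_sphere R 3).
exact: (torus_VR_homotopy_equivalent R _ torus7_certificate).
Qed.
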